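(* Let $\mathbb{K}$ be a field of characteristic $0$ and let $f\in\mathbb{K}[X]$ be a square-free monic polynomial of odd degree $2g+1$ with $g\ge1$; put $L:=\mathbb{K}[X]/\langle f\rangle$. Then the genus map $\Psi\colon\mathrm{Cl}^{tw}_{\mathbb{K}[X]}(4f)/\mathrm{Cl}^{tw}_{\mathbb{K}[X]}(4f)^\square\to L^\times/\mathbb{K}^\times L^{\times\square}$ is injective; that is, the principal genus of $\mathrm{Cl}^{tw}_{\mathbb{K}[X]}(4f)$ equals its subgroup of squares.
   Context: Forms over $\mathbb{K}[X]$: $[a,b,c]:=ax^2+bxy+cy^2$, primitive if $\langle a,b,c\rangle=\mathbb{K}[X]$, discriminant $b^2-4ac$; twisted action $(M\cdot q)(x,y)=\frac{1}{\det M}q(\alpha x+\beta y,\gamma x+\delta y)$ for $M=\begin{pmatrix}\alpha&\beta\\ \gamma&\delta\end{pmatrix}\in\mathrm{GL}_2(\mathbb{K}[X])$. $\mathrm{Cl}^{tw}_{\mathbb{K}[X]}(4f)$ is the set of orbits of primitive forms of discriminant $4f$ (written $[a,2b,c]$), a group via the bijection with $\mathrm{Pic}(\mathbb{K}[X,Y]/\langle Y^2-f\rangle)$ sending the class of $[a,2b,c]$ to the class of $\langle a,Y-b\rangle$. Every class has a representative $[a,2b,c]$ with $a$ coprime to $f$, and $\Psi$ sends the class of such a form to $a^{-1}\mathbb{K}^\times L^{\times\square}$ (well defined homomorphism). The principal genus is the kernel of the induced homomorphism $\mathrm{Cl}^{tw}_{\mathbb{K}[X]}(4f)\to L^\times/\mathbb{K}^\times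 L^{\times\square}$. *)

(* Defs.v *)
From mathcomp Require Import all_boot all_order all_algebra qpoly.
From mathcomp Require Import boolp classical_sets functions.
From mathcomp Require Import ring.

Set Implicit Arguments.
Unset Strict Implicit.
Unset Printing Implicit Defensive.

Import GRing.Theory.
Local Open Scope classical_set_scope.
Local Open Scope ring_scope.

Definition square_free (K : fieldType) (f : {poly K}) : Prop :=
  forall p : {poly K}, p ^+ 2 %| f -> size p = 1%N.

Definition is_ideal (R : comNzRingType) (I : set R) : Prop :=
  [/\ I 0, (forall x y, I x -> I y -> I (x + y))
    & (forall r x, I x -> I (r * x))].

Definition ideal_gen (R : comNzRingType) (S : set R) : set R :=
  smallest (@is_ideal R) S.

Definition ideal_mul (R : comNzRingType) (I J : set R) : set R :=
  ideal_gen [set x * y | x in I & y in J].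

(* Pic R is the group of invertible fractional ideals modulo the principal
   ones.  Fractional ideals are represented here by integral ones, after
   clearing denominators, so "principal" becomes "up to regular factors". *)
Definition invertible (R : comNzRingType) (I : set R) : Prop :=
  is_ideal I /\
  exists (J : set R) (r : R),
    [/\ is_ideal J, GRing.lreg r & ideal_mul I J = ideal_gen [set r]].

Definition ideal_class (R : comNzRingType) (I : set R) : set (set R) :=
  [set J | invertible J /\
    exists r s : R, [/\ GRing.lreg r, GRing.lreg s &
      [set r * x | x in I] = [set s * y | y in J]]].

Definition Pic (R : comNzRingType) : set (set (set R)) :=
  [set ideal_class I | I in @invertible R].

Definition pic_mul (R : comNzRingType) (P Q : set (set R)) : set (set R) :=
  \bigcup_(I in P) \bigcup_(J in Q) ideal_class (ideal_mul I J).

(* Form a b c stands for [a, b, c] = a x^2 + b x y + c y^2. *)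
Record form (K : fieldType) :=
  Form { qa : {poly K}; qb : {poly K}; qc : {poly K} }.

Definition form_eval (K : fieldType) (q : form K) (x y : {poly K}) :
    {poly K} :=
  qa q * x ^+ 2 + qb q * x * y + qc q * y ^+ 2.

Definition primitive (K : fieldType) (q : form K) : Prop :=
  ideal_gen [set qa q; qb q; qc q] = [set: {poly K}].

Definition disc (K : fieldType) (q : form K) : {poly K} :=
  qb q ^+ 2 - 4%:R * qa q * qc q.

(* The coefficients of q(alpha x + beta y, gamma x + delta y) / det M;
   see form_actE. *)
Definition form_act (K : fieldType) (M : 'M[{poly K}]_2) (q : form K) :
    form K :=
  let al := M 0 0 in let be := M 0 1 in
  let ga := M 1 0 in let de := M 1 1 in
  let d := (\det M)^-1 in
  Form (d * form_eval q al ga)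
       (d * (qa q * al * be *+ 2 + qb q * (al * de + be * ga)
             + qc q * ga * de *+ 2))
       (d * form_eval q be de).

Lemma form_actE (K : fieldType) (M : 'M[{poly K}]_2) (q : form K) x y :
  form_eval (form_act M q) x y =
  (\det M)^-1 * form_eval q (M 0 0 * x + M 0 1 * y) (M 1 0 * x + M 1 1 * y).
Proof.
rewrite /form_act /form_eval /=.
move: (M 0 0) (M 0 1) (M 1 0) (M 1 1) (\det M)^-1 => al be ga de d.
ring.
Qed.

Definition form_orbit (K : fieldType) (q : form K) : set (form K) :=
  [set form_act M q | M in [set M | M \in unitmx]].

Definition forms (K : fieldType) (f : {poly K}) : set (form K) :=
  [set q | primitive q /\ disc q = 4%:R * f].

(* The underlying set of Cl^tw(4 f); its elements are orbits. *)
Definition Cl (K : fieldType) (f : {poly K}) : set (set (form K)) :=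
  [set form_orbit q | q in forms f].

(* K[X, Y] / (Y^2 - f); qpolyC embeds K[X] and 'qX is the class of Y. *)
Notation coord_ring f := {poly %/ 'X^2 - f%:P}.

Definition form_ideal (K : fieldType) (f a b : {poly K}) :
    set (coord_ring f) :=
  ideal_gen [set qpolyC _ a; 'qX - qpolyC _ b].
Arguments form_ideal {K} f a b _.

(* The bijection Cl^tw(4 f) -> Pic(K[X, Y] / (Y^2 - f)).  The union runs over
   all representatives [a, 2 b, c] of C, which yield the same ideal class. *)
Definition cl_pic (K : fieldType) (f : {poly K}) (C : set (form K)) :
    set (set (coord_ring f)) :=
  [set I | exists a b c, C (Form a (b *+ 2) c) /\
                         ideal_class (form_ideal f a b) I].
Arguments cl_pic {K} f C _.

(* The inverse bijection: the orbit mapped to P, as a set of forms. *)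
Definition pic_cl (K : fieldType) (f : {poly K})
    (P : set (set (coord_ring f))) : set (form K) :=
  [set q | forms f q /\ cl_pic f (form_orbit q) = P].
Arguments pic_cl {K} {f} P _.

Definition cl_mul (K : fieldType) (f : {poly K}) (C D : set (form K)) :
    set (form K) :=
  pic_cl (pic_mul (cl_pic f C) (cl_pic f D)).

Definition cl_squares (K : fieldType) (f : {poly K}) : set (set (form K)) :=
  [set cl_mul f C C | C in Cl f].

Definition cl_coset (K : fieldType) (f : {poly K}) (C : set (form K)) :
    set (set (form K)) :=
  [set cl_mul f C S | S in cl_squares f].

Definition Cl_mod_squares (K : fieldType) (f : {poly K}) :
    set (set (set (form K))) :=
  [set cl_coset f C | C in Cl f].

(* The coset u K^* L^*2 of a unit u of L = K[X] / (f). *)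
Definition genus_coset (K : fieldType) (f : {poly K}) (u : {poly %/ f}) :
    set {poly %/ f} :=
  [set v | exists (k : K) (l : {poly %/ f}),
    [/\ k != 0, l \is a GRing.unit & v = u * (k *: l ^+ 2)]].

(* The union runs over all representatives [a, 2 b, c] of C with a coprime
   to f, which yield the same coset. *)
Definition cl_genus (K : fieldType) (f : {poly K}) (C : set (form K)) :
    set {poly %/ f} :=
  [set v | exists a b c, [/\ C (Form a (b *+ 2) c), coprimep a f
                           & genus_coset (in_qpoly f a)^-1 v]].
Arguments cl_genus {K} f C _.

(* The map induced by cl_genus on Cl^tw(4 f) modulo squares; cl_genus is
   constant on each coset Q. *)
Definition genus_map (K : fieldType) (f : {poly K})
    (Q : set (set (form K))) : set {poly %/ f} :=
  \bigcup_(C in Q) cl_genus f C.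
Arguments genus_map {K} f Q _.

Definition principal_genus (K : fieldType) (f : {poly K}) :
    set (set (form K)) :=
  [set C | Cl f C /\ cl_genus f C = genus_coset 1].

(* Main.v *)
Require Import Defs.
From HB Require Import structures.
From mathcomp Require Import all_boot all_order all_algebra qpoly.
From mathcomp Require Import boolp classical_sets functions.
From mathcomp Require Import ring zify.

(** Let R = K[X, Y] / (Y^2 - f), and let I(a, b) = (a, Y - b) be the ideal of
    the form [a, 2b, c].  Forms are equivalent exactly when their ideals are
    proportional, and I(a1, b) I(a2, b) = I(a1 a2, b) when a1, a2, 2b generate
    the unit ideal.  As every form properly represents values coprime to any
    given h, the genus is multiplicative, and it remains to see that a class
    of trivial genus is a square.  Suppose a = k l^2 mod f.  The congruences
    P = l w mod f and P = b v mod a have, by counting dimensions, a nonzero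
    solution for which P^2, f v^2 and a w^2 all have degree below deg (a f);
    this is where deg f is odd.  Now a f divides P^2 - f v^2 - k^-1 a w^2,
    which therefore vanishes.  With P = a u + b v it follows that the form
    takes the value k^-1 w^2 at (u, v), so that its class contains some
    [w^2, 2b', c'], the square of [w, 2b', w c']. *)

Import GRing.Theory.

Local Open Scope ring_scope.

(** * Products and proportionality of ideals in a commutative ring *)

Section Ideals.
Local Open Scope classical_set_scope.
Context {R : comNzRingType}.
Implicit Types (I J L S : set R) (r s x y : R).

Lemma ideal_gen_ideal S : is_ideal (ideal_gen S).
Proof.
split=> [X [[X0 _ _] _]//|x y Sx Sy X XS|r x Sx X XS].
  by have [[_ XD _] _] := XS; apply: XD; [exact: Sx|exact: Sy].
by have [[_ _ XM] _] := XS; apply: XM; exact: Sx.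
Qed.

Lemma ideal_gen_sub S I : is_ideal I -> S `<=` I -> ideal_gen S `<=` I.
Proof. exact: smallest_sub. Qed.

Lemma ideal_mul_ideal I J : is_ideal (ideal_mul I J).
Proof. exact: ideal_gen_ideal. Qed.

Lemma mem_ideal_mul I J x y : I x -> J y -> ideal_mul I J (x * y).
Proof. by move=> Ix Jy; apply: sub_gen_smallest; exists x => //; exists y. Qed.

Lemma ideal_mul_sub I J L : is_ideal L ->
  (forall x y, I x -> J y -> L (x * y)) -> ideal_mul I J `<=` L.
Proof.
move=> idL IJL; apply: ideal_gen_sub => // _ [x Ix [y Jy <-]].
exact: IJL.
Qed.

Lemma ideal_mulC I J : ideal_mul I J = ideal_mul J I.
Proof.
by rewrite eqEsubset; split; apply: ideal_mul_sub (ideal_mul_ideal _ _) _;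
  move=> x y Ix Jy; rewrite mulrC; exact: mem_ideal_mul.
Qed.

Lemma ideal_mulA I J L :
  ideal_mul I (ideal_mul J L) = ideal_mul (ideal_mul I J) L.
Proof.
have half (A B C : set R) :
    ideal_mul (ideal_mul A B) C `<=` ideal_mul A (ideal_mul B C).
  apply: ideal_mul_sub (ideal_mul_ideal _ _) _ => x y ABx Cy; move: x ABx.
  have [T0 TD TM] := ideal_mul_ideal A (ideal_mul B C).
  (* For fixed y the x with x y in the target form an ideal, so it is enough to take x = u v with u
     in A and v in B. *)
  suff: ideal_mul A B `<=` [set x | ideal_mul A (ideal_mul B C) (x * y)] by [].
  apply: ideal_mul_sub.
    split=> [|u v Au Av|r u Au] /=; first by rewrite mul0r.
      by rewrite mulrDl; exact: TD.
    by rewrite -mulrA; exact: TM.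
  by move=> u v Au Bv /=; rewrite -mulrA; do 2 apply: mem_ideal_mul => //.
rewrite eqEsubset; split; last exact: half.
(* By commutativity the other inclusion is [half] with the factors in reverse order. *)
by rewrite ideal_mulC (ideal_mulC J) (ideal_mulC _ L) (ideal_mulC I); exact: half.
Qed.

Lemma ideal_mulACA I J L S :
  ideal_mul (ideal_mul I J) (ideal_mul L S) =
  ideal_mul (ideal_mul I L) (ideal_mul J S).
Proof.
by rewrite -!ideal_mulA (ideal_mulA J) (ideal_mulC J) -ideal_mulA.
Qed.

Lemma ideal_mul_unit I : is_ideal I -> ideal_mul setT I = I.
Proof.
move=> idI; rewrite eqEsubset; split=> [|x Ix]; last first.
  by rewrite -[x]mul1r; exact: mem_ideal_mul.
by apply: ideal_mul_sub => // r x _ Ix; have [_ _ IM] := idI; exact: IM.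
Qed.

Definition ideal_scale r I : set R := [set r * x | x in I].

Lemma ideal_scale1 I : ideal_scale 1 I = I.
Proof.
rewrite eqEsubset; split=> [_ [x Ix <-]|x Ix]; first by rewrite mul1r.
by exists x; rewrite ?mul1r.
Qed.

Lemma ideal_scaleM r s I : ideal_scale r (ideal_scale s I) = ideal_scale (r * s) I.
Proof.
rewrite eqEsubset; split=> [_ [_ [x Ix <-] <-]|_ [x Ix <-]].
  by exists x; rewrite ?mulrA.
by exists (s * x); rewrite ?mulrA//; exists x.
Qed.

Lemma ideal_scale_ideal r I : is_ideal I -> is_ideal (ideal_scale r I).
Proof.
case=> I0 ID IM; split; first by exists 0; rewrite ?mulr0.
  by move=> _ _ [x Ix <-] [y Iy <-]; exists (x + y); rewrite ?mulrDr//; exact: ID.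
by move=> s _ [x Ix <-]; exists (s * x); rewrite 1?mulrCA//; exact: IM.
Qed.

Lemma ideal_mul_scalel r I J :
  ideal_mul (ideal_scale r I) J = ideal_scale r (ideal_mul I J).
Proof.
rewrite eqEsubset; split.
  apply: ideal_mul_sub; first exact/ideal_scale_ideal/ideal_mul_ideal.
  move=> _ y [x Ix <-] Jy; exists (x * y); rewrite ?mulrA//.
  exact: mem_ideal_mul.
move=> _ [x IJx <-]; move: x IJx.
have [T0 TD TM] := ideal_mul_ideal (ideal_scale r I) J.
suff: ideal_mul I J `<=` [set x | ideal_mul (ideal_scale r I) J (r * x)] by [].
apply: ideal_mul_sub.
  split=> [|u v Au Av|s u Au] /=; first by rewrite mulr0.
    by rewrite mulrDr; exact: TD.
  by rewrite mulrCA; exact: TM.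
by move=> u v Iu Jv /=; rewrite mulrA; apply: mem_ideal_mul => //; exists u.
Qed.

Lemma ideal_mul_scale r s I J :
  ideal_mul (ideal_scale r I) (ideal_scale s J) =
  ideal_scale (r * s) (ideal_mul I J).
Proof.
by rewrite ideal_mul_scalel ideal_mulC ideal_mul_scalel ideal_scaleM ideal_mulC.
Qed.

Lemma ideal_gen1 r : ideal_gen [set r] = ideal_scale r setT.
Proof.
rewrite eqEsubset; split.
  apply: ideal_gen_sub; first exact: ideal_scale_ideal.
  by move=> _ ->; exists 1; rewrite ?mulr1.
move=> _ [x _ <-]; have [_ _ TM] := ideal_gen_ideal [set r].
by rewrite mulrC; apply: TM; exact: sub_gen_smallest.
Qed.

(** The relation used in [ideal_class], freed from invertibility so that it is an equivalence on all
    subsets and compatible with products. *)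
Definition ideal_equiv I J : Prop :=
  exists r s, [/\ GRing.lreg r, GRing.lreg s & ideal_scale r I = ideal_scale s J].

Lemma ideal_equiv_refl I : ideal_equiv I I.
Proof. by exists 1, 1; split=> //; exact: lreg1. Qed.

Lemma ideal_equiv_sym {I J} : ideal_equiv I J -> ideal_equiv J I.
Proof. by case=> r [s [rr rs e]]; exists s, r. Qed.

Lemma ideal_equiv_trans {I J L} :
  ideal_equiv I J -> ideal_equiv J L -> ideal_equiv I L.
Proof.
case=> r [s [rr rs e]] [r' [s' [rr' rs' e']]].
exists (r' * r), (s * s'); split; try exact: lregM.
by rewrite -!ideal_scaleM e -e' !ideal_scaleM mulrC.
Qed.

Lemma ideal_equiv_mul {I J I' J'} : ideal_equiv I J -> ideal_equiv I' J' ->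
  ideal_equiv (ideal_mul I I') (ideal_mul J J').
Proof.
case=> r [s [rr rs e]] [r' [s' [rr' rs' e']]].
exists (r * r'), (s * s'); split; try exact: lregM.
by rewrite -!ideal_mul_scale e e'.
Qed.

Lemma ideal_equiv_scale r I : GRing.lreg r -> ideal_equiv (ideal_scale r I) I.
Proof.
move=> rr; exists 1, r; split=> //; first exact: lreg1.
by rewrite ideal_scale1.
Qed.

Lemma ideal_class_eq {I J} : ideal_equiv I J -> ideal_class I = ideal_class J.
Proof.
move=> IJ; rewrite eqEsubset; split=> L [invL ?]; split=> //.
  exact: ideal_equiv_trans (ideal_equiv_sym IJ) _.
exact: ideal_equiv_trans IJ _.
Qed.

Lemma ideal_class_refl {I} : invertible I -> ideal_class I I.
Proof. by move=> invI; split=> //; exact: ideal_equiv_refl. Qed.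

(** Invertibility puts J into its own class, hence into that of I. *)
Lemma ideal_class_inj {I J} : invertible J ->
  ideal_class I = ideal_class J -> ideal_equiv I J.
Proof. by move=> /ideal_class_refl + e; rewrite -e => -[]. Qed.

Lemma pic_mul_class I J : invertible I -> invertible J ->
  pic_mul (ideal_class I) (ideal_class J) = ideal_class (ideal_mul I J).
Proof.
move=> invI invJ; rewrite eqEsubset; split=> [L [I' [_ II'] [J' [_ JJ']]]|L IJL].
  by rewrite -(ideal_class_eq (ideal_equiv_mul II' JJ')).
by exists I; [exact: ideal_class_refl|exists J => //; exact: ideal_class_refl].
Qed.

End Ideals.

(** * The coordinate ring as a free K[X]-module with basis 1, Y *)

Section QuadraticRing.
Context {K : fieldType} {f : {poly K}}.
Implicit Types (x y a b : {poly K}) (z : coord_ring f).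

Let h : {poly {poly K}} := 'X^2 - f%:P.

Let size_h : size h = 3.
Proof. by rewrite size_XnsubC. Qed.

(** Quotients are taken modulo [mk_monic h], which falls back on another polynomial unless h is
    monic and nonconstant. *)
Let mk_monic_h : mk_monic h = h.
Proof. by rewrite /mk_monic size_h monicXnsubC. Qed.

Lemma qX_sqr : ('qX : coord_ring f) * 'qX = qpolyC _ f.
Proof.
apply: val_inj; rewrite [LHS]poly_of_qpolyM [RHS]qpolyCE qpolyXE ?size_h ?monicXnsubC//.
rewrite mk_monic_h.
have -> : 'X * 'X = 1 * h + f%:P by rewrite /h; ring.
rewrite Pdiv.RingMonic.rmodp_addl_mul_small ?monicXnsubC// size_h.
by rewrite (leq_ltn_trans (size_polyC_leq1 _)).
Qed.

Definition qel x y : coord_ring f := qpolyC _ x + qpolyC _ y * 'qX.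

Lemma qelD x y x' y' : qel x y + qel x' y' = qel (x + x') (y + y').
Proof. by rewrite /qel !rmorphD /=; ring. Qed.

Lemma qelM x y x' y' :
  qel x y * qel x' y' = qel (x * x' + f * y * y') (x * y' + y * x').
Proof.
rewrite /qel !rmorphD !rmorphM /= -qX_sqr; ring.
Qed.

Lemma qpolyC_qel x : qpolyC _ x = qel x 0.
Proof. by rewrite /qel rmorph0 mul0r addr0. Qed.

Lemma qXB_qel b : 'qX - qpolyC _ b = qel (- b) 1.
Proof. by rewrite /qel rmorphN rmorph1 /=; ring. Qed.

Lemma val_qel x y : val (qel x y) = x%:P + y%:P * 'X.
Proof.
have -> : val (qel x y) =
    x%:P + Pdiv.CommonRing.rmodp (y%:P * val ('qX : coord_ring f)) (mk_monic h) by [].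
rewrite [val _]qpolyXE ?size_h ?monicXnsubC// mk_monic_h Pdiv.CommonRing.rmodp_small //.
by rewrite size_h -[_ * _]addr0 size_MXaddC; case: ifP => // _; rewrite ltnS (leq_ltn_trans (size_polyC_leq1 _)).
Qed.

Lemma qel_inj x y x' y' : qel x y = qel x' y' -> x = x' /\ y = y'.
Proof.
move/(congr1 val); rewrite !val_qel => e.
have := congr1 (fun p : {poly {poly K}} => p`_0) e.
have := congr1 (fun p : {poly {poly K}} => p`_1) e.
by rewrite !(coefD, coefMX, coefC) /= !(add0r, addr0).
Qed.

Lemma qelP z : exists x y, z = qel x y.
Proof.
exists (val z)`_0, (val z)`_1; apply: val_inj; rewrite val_qel.
apply/polyP => -[|[|i]]; rewrite !(coefD, coefMX, coefC) /= ?(add0r, addr0)//.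
rewrite nth_default // (leq_trans (size_npoly z)) // mk_monic_h size_h.
exact.
Qed.

Lemma qel0 : qel 0 0 = 0.
Proof. by rewrite -qpolyC_qel rmorph0. Qed.

End QuadraticRing.
Arguments qel {K} f x y.

(** * Equivalence of forms and proportionality of their ideals *)

Section FormIdeals.
Local Open Scope classical_set_scope.
Context {K : fieldType} {f : {poly K}}.
Context (two_neq0 : 2%:R != 0 :> K).
Context (sqrf_free : square_free f).
Context (f_aniso : forall x y : {poly K}, x ^+ 2 = f * y ^+ 2 -> x = 0 /\ y = 0).
Implicit Types (a b c u v x y : {poly K}) (q : Defs.form K).

Lemma mulr2n_inj : injective (fun x : {poly K} => x *+ 2).
Proof. by move=> x y /=; rewrite -!scaler_nat => /(scalerI two_neq0). Qed.

(** The K[X]-span of a and b - Y is already an ideal: Y a = b a - a (b - Y), and b^2 - a c = f gives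
    Y (b - Y) = c a - b (b - Y). *)
Lemma form_idealP a b c (z : coord_ring f) : b ^+ 2 - a * c = f ->
  form_ideal f a b z <-> exists u v, z = qel f (a * u + b * v) (- v).
Proof.
move=> fE; split=> [|[u [v ->]]].
  suff: form_ideal f a b `<=` [set z | exists u v, z = qel f (a * u + b * v) (- v)].
    exact.
  apply: ideal_gen_sub.
    split=> [|_ _ [u [v ->]] [u' [v' ->]]|r _ [u [v ->]]] /=.
    - by exists 0, 0; rewrite !mulr0 addr0 oppr0 qel0.
    - by exists (u + u'), (v + v'); rewrite qelD; congr qel; ring.
    have [x [y ->]] := qelP r.
    exists (x * u + b * y * u + c * y * v), (x * v - y * (a * u + b * v)).
    by rewrite qelM; congr qel; rewrite -?fE; ring.
  move=> _ [->|->] /=.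
    by exists 1, 0; rewrite qpolyC_qel; congr qel; ring.
  by exists 0, (-1); rewrite qXB_qel; congr qel; ring.
have [_ ID IM] := ideal_gen_ideal [set (qpolyC _ a : coord_ring f); 'qX - qpolyC _ b].
have -> : qel f (a * u + b * v) (- v) =
    qel f u 0 * qpolyC _ a + qel f (- v) 0 * ('qX - qpolyC _ b).
  by rewrite qpolyC_qel qXB_qel !qelM qelD; congr qel; ring.
by apply: ID; apply: IM; apply: sub_gen_smallest; [left|right].
Qed.

(** Multiplying x + y Y by its conjugate x - y Y gives the norm x^2 - f y^2, which is nonzero by
    [f_aniso] and can be cancelled in K[X]. *)
Lemma qel_lreg (z : coord_ring f) : z != 0 -> GRing.lreg z.
Proof.
have [x [y ->]] := qelP z => z0 s t.
have [x' [y' ->]] := qelP s; have [x'' [y'' ->]] := qelP t.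
move/(congr1 ( *%R (qel f x (- y)))); rewrite !mulrA !qelM.
have -> : x * x + f * - y * y = x ^+ 2 - f * y ^+ 2 by ring.
have -> : x * y + - y * x = 0 by ring.
rewrite !(mul0r, mulr0, addr0).
have N0 : x ^+ 2 - f * y ^+ 2 != 0.
  apply: contra z0; rewrite subr_eq0 => /eqP /f_aniso[-> ->].
  by rewrite qel0.
by case/qel_inj => /(mulfI N0) -> /(mulfI N0) ->.
Qed.

(** With a = 0 the polynomial f would be the square b^2, against anisotropy at (b, 1). *)
Lemma lead_form_neq0 a b c : b ^+ 2 - a * c = f -> a != 0.
Proof.
move=> fE; apply/eqP => a0; have /f_aniso[_ /eqP] : b ^+ 2 = f * 1 ^+ 2.
  by rewrite -fE a0; ring.
by rewrite oner_eq0.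
Qed.

(** Clearing the inverse determinant from [form_act] leaves polynomial identities in the matrix
    entries. *)
Lemma form_orbitP a b c q :
  form_orbit (Form a (b *+ 2) c) q <->
  exists al be ga de : {poly K}, [/\ al * de - be * ga \is a GRing.unit,
    (al * de - be * ga) * qa q = a * al ^+ 2 + b * al * ga *+ 2 + c * ga ^+ 2,
    (al * de - be * ga) * qb q =
      (a * al * be + b * (al * de + be * ga) + c * ga * de) *+ 2
  & (al * de - be * ga) * qc q = a * be ^+ 2 + b * be * de *+ 2 + c * de ^+ 2].
Proof.
have det2 (M : 'M[{poly K}]_2) : \det M = M 0 0 * M 1 1 - M 0 1 * M 1 0.
  rewrite (expand_det_row M 0) big_ord_recl big_ord1 /cofactor !det_mx11.
  rewrite !mxE /= expr0 expr1 mul1r mulN1r mulrN.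
  by congr (_ * M _ _ - M _ _ * M _ _); apply: val_inj.
split=> [[M Mu <-]|[al [be [ga [de [du Ha Hb Hc]]]]]].
  exists (M 0 0), (M 0 1), (M 1 0), (M 1 1); rewrite -det2.
  rewrite /= unitmxE in Mu.
  split=> //=; rewrite !mulrA divrr // mul1r /form_eval /=; ring.
pose M : 'M[{poly K}]_2 := \matrix_(i, j)
  if i == 0 then (if j == 0 then al else be) else (if j == 0 then ga else de).
have dM : \det M = al * de - be * ga by rewrite det2 !mxE.
exists M; first by rewrite /= unitmxE dM.
case: q Ha Hb Hc => a' b' c' /= Ha Hb Hc.
rewrite /form_act dM /form_eval !mxE /=.
by congr Form; apply: (mulrI du); rewrite mulrA divrr // mul1r ?Ha ?Hb ?Hc; ring.
Qed.

(** The norm of a u + b v - v Y is a times the value of [a, 2b, c] at (u, v), so a form is, up to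
    this factor, the norm on its ideal in the basis a, b - Y. Proportional ideals differ by a change
    of basis of arbitrary unit determinant, which the twisted action absorbs. *)
Lemma form_orbit_ideal_equiv a b c a' b' c' :
  b ^+ 2 - a * c = f -> b' ^+ 2 - a' * c' = f ->
  form_orbit (Form a (b *+ 2) c) (Form a' (b' *+ 2) c') <->
  ideal_equiv (form_ideal f a b) (form_ideal f a' b').
Proof.
move=> fE fE'; have a0 := lead_form_neq0 _ _ _ fE.
have a0' := lead_form_neq0 _ _ _ fE'.
split=> [/form_orbitP[al [be [ga [de [/= du Ha Hb _]]]]]|].
  (* With e = a al + (b - Y) ga in the first ideal and e' its conjugate,
     e' times the first ideal is a d times the second. *)
  move: Hb; rewrite mulrnAr => /mulr2n_inj Hb.
  set d := al * de - be * ga in du Ha Hb.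
  have key u v : qel f (a * al + b * ga) ga *
        qel f (a * (al * u + be * v) + b * (ga * u + de * v)) (- (ga * u + de * v)) =
      qel f (a * d) 0 * qel f (a' * u + b' * v) (- v).
    rewrite !qelM; congr qel.
      have -> : a * d * (a' * u + b' * v) + f * 0 * - v =
        a * ((d * a') * u + (d * b') * v) by ring.
      by rewrite Ha Hb -fE; ring.
    by rewrite /d; ring.
  exists (qel f (a * al + b * ga) ga), (qel f (a * d) 0); split.
  - apply: qel_lreg; apply/eqP; rewrite -qel0 => /qel_inj[e1 e2].
    move: e1; rewrite e2 mulr0 addr0 => /eqP.
    rewrite mulf_eq0 (negPf a0) /= => /eqP e1.
    by move: du; rewrite /d e1 e2 mulr0 mul0r subr0 unitr0.
  - apply: qel_lreg; apply/eqP; rewrite -qel0 => /qel_inj[/eqP + _].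
    rewrite mulf_eq0 (negPf a0) /= => /eqP e1.
    by move: du; rewrite e1 unitr0.
  rewrite eqEsubset; split=> _ [z /(form_idealP _ _ _ _ _)Iz <-].
    have [u [v ->]] := Iz _ fE.
    (* The inverse matrix is applied to (u, v) by Cramer's rule. *)
    have eu : u = al * (d^-1 * (de * u - be * v)) + be * (d^-1 * (al * v - ga * u)).
      by rewrite -[LHS]mul1r -(mulVr du) [in X in X * _]/d; ring.
    have ev : v = ga * (d^-1 * (de * u - be * v)) + de * (d^-1 * (al * v - ga * u)).
      by rewrite -[LHS]mul1r -(mulVr du) [in X in X * _]/d; ring.
    exists (qel f (a' * (d^-1 * (de * u - be * v)) + b' * (d^-1 * (al * v - ga * u)))
             (- (d^-1 * (al * v - ga * u)))).
      by apply/(form_idealP _ _ _ _ fE'); do 2 eexists.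
    by rewrite -key -eu -ev.
  have [u [v ->]] := Iz _ fE'.
  exists (qel f (a * (al * u + be * v) + b * (ga * u + de * v)) (- (ga * u + de * v))).
    by apply/(form_idealP _ _ _ _ fE); do 2 eexists.
  by rewrite key.
case=> r [s [rr rs]]; set I := form_ideal f a b; set I' := form_ideal f a' b' => e.
have Ia : I (qel f a 0) by apply/(form_idealP _ _ _ _ fE); exists 1, 0; congr qel; ring.
have Ib : I (qel f b (-1)) by apply/(form_idealP _ _ _ _ fE); exists 0, 1; congr qel; ring.
have Ia' : I' (qel f a' 0) by apply/(form_idealP _ _ _ _ fE'); exists 1, 0; congr qel; ring.
have Ib' : I' (qel f b' (-1)) by apply/(form_idealP _ _ _ _ fE'); exists 0, 1; congr qel; ring.
have II' z : I' z -> exists u v, s * z = r * qel f (a * u + b * v) (- v).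
  move=> I'z; have [w /(form_idealP _ _ _ _ fE)[u [v ->]] <-] : ideal_scale r I (s * z).
    by rewrite e; exists z.
  by exists u, v.
have I'I z : I z -> exists u v, r * z = s * qel f (a' * u + b' * v) (- v).
  move=> Iz; have [w /(form_idealP _ _ _ _ fE')[u [v ->]] <-] : ideal_scale s I' (r * z).
    by rewrite -e; exists z.
  by exists u, v.
(* The columns ([al], [ga]) and ([be], [de]) express s a' and s (b' - Y) in the basis r a, r (b -
   Y); the primed entries express the way back. *)
have [al [ga e1]] := II' _ Ia'; have [be [de e2]] := II' _ Ib'.
have [al' [ga' e1']] := I'I _ Ia; have [be' [de' e2']] := I'I _ Ib.
have back u v : s * qel f (a' * u + b' * v) (- v) =
    r * qel f (u * (a * al + b * ga) + v * (a * be + b * de)) (- (u * ga + v * de)).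
  have -> : qel f (a' * u + b' * v) (- v) =
      qel f u 0 * qel f a' 0 + qel f v 0 * qel f b' (-1).
    by rewrite !qelM qelD; congr qel; ring.
  rewrite mulrDr !(mulrCA s) e1 e2 !(mulrCA _ r) -mulrDr !qelM qelD.
  by congr (_ * qel f _ _); ring.
move: e1' e2'; rewrite !back => /rr/qel_inj[p1 /esym p2] /rr/qel_inj[p3 /esym p4].
(* Comparing coordinates shows that the two matrices are inverse to each other, so the determinant
   is a unit. *)
have m12 : al' * ga + ga' * de = 0 by apply: oppr_inj; rewrite p2 oppr0.
have m22 : be' * ga + de' * de = 1 by apply: oppr_inj.
have m11 : al' * al + ga' * be = 1.
  apply: (mulfI a0); rewrite mulr1 [RHS]p1.
  rewrite [RHS](_ : _ = a * (al' * al + ga' * be) + b * (al' * ga + ga' * de)); last by ring.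
  by rewrite m12; ring.
have m21 : be' * al + de' * be = 0.
  apply: (mulfI a0); apply: (addIr b); rewrite mulr0 add0r [RHS]p3.
  rewrite [RHS](_ : _ = a * (be' * al + de' * be) + b * (be' * ga + de' * de)); last by ring.
  by rewrite m22; ring.
have dd : (al * de - be * ga) * (al' * de' - ga' * be') = 1.
  have -> : (al * de - be * ga) * (al' * de' - ga' * be') =
    (al' * al + ga' * be) * (be' * ga + de' * de) -
    (be' * al + de' * be) * (al' * ga + ga' * de) by ring.
  by rewrite m11 m12 m21 m22; ring.
have du : al * de - be * ga \is a GRing.unit.
  by apply/unitrPr; exists (al' * de' - ga' * be').
(* Both sides equal s a' (b' - Y). Cancelling r leads to the linear relations [g3] and [g4], which
   yield the first two coefficients of the new form. *)
have : r * (qel f a' 0 * qel f (a * be + b * de) (- de)) =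
    r * (qel f b' (-1) * qel f (a * al + b * ga) (- ga)).
  by rewrite !(mulrCA r) -e1 -e2; ring.
move/rr; rewrite !qelM => /qel_inj[g1 g2].
have g3 : a' * de - b' * ga = a * al + b * ga.
  apply/eqP; rewrite -subr_eq0; apply/eqP.
  have -> : a' * de - b' * ga - (a * al + b * ga) =
    (b' * - ga + - 1 * (a * al + b * ga)) - (a' * - de + 0 * (a * be + b * de)) by ring.
  by rewrite g2 subrr.
have g4 : b' * al - a' * be = b * al + c * ga.
  apply: (mulfI a0); apply/eqP; rewrite -subr_eq0; apply/eqP.
  have -> : a * (b' * al - a' * be) - a * (b * al + c * ga) =
     (b' * (a * al + b * ga) + (b ^+ 2 - a * c) * - 1 * - ga) -
     (a' * (a * be + b * de) + (b ^+ 2 - a * c) * 0 * - de)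
     + b * ((a' * de - b' * ga) - (a * al + b * ga)) by ring.
  by rewrite fE g1 g3 !subrr mulr0 addr0.
set d := al * de - be * ga in du.
have Ha : d * a' = a * al ^+ 2 + b * al * ga *+ 2 + c * ga ^+ 2.
  have -> : d * a' = al * (a' * de - b' * ga) + ga * (b' * al - a' * be) by rewrite /d; ring.
  by rewrite g3 g4; ring.
have Hb : d * b' = a * al * be + b * (al * de + be * ga) + c * ga * de.
  have -> : d * b' = be * (a' * de - b' * ga) + de * (b' * al - a' * be) by rewrite /d; ring.
  by rewrite g3 g4; ring.
apply/form_orbitP; exists al, be, ga, de; split=> //=; rewrite -/d.
  by rewrite mulrnAr Hb.
(* After multiplication by d a' the identity for the last coefficient follows from the other two and
   the equality of discriminants. *)
have d0 : d != 0 by apply: contraTneq du => ->; rewrite unitr0.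
apply: (mulfI a0'); apply: (mulfI d0).
have -> : d * (a' * (d * c')) = (d * b') ^+ 2 - d ^+ 2 * (b' ^+ 2 - a' * c') by ring.
rewrite mulrA Ha fE' -fE Hb /d; ring.
Qed.

End FormIdeals.

(** * The class group expressed through ideals *)

Section ClassGroup.
Local Open Scope classical_set_scope.
Context {K : fieldType} {f : {poly K}}.
Context (two_neq0 : 2%:R != 0 :> K).
Context (sqrf_free : square_free f).
Context (f_aniso : forall x y : {poly K}, x ^+ 2 = f * y ^+ 2 -> x = 0 /\ y = 0).
Implicit Types (a b c u v x y : {poly K}) (q : Defs.form K).
Implicit Types I J : set (coord_ring f).

Lemma bezout x y : exists u v, u * x + v * y = gcdp x y.
Proof.
have [[u v] /= /andP[/dvdpP[w ->] _]] := Bezoutp x y.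
by exists (w * u), (w * v); ring.
Qed.

Lemma bezout_coprime x y : coprimep x y -> exists u v, u * x + v * y = 1.
Proof.
move=> /Bezout_coprimepP[[u v] /= /andP[/dvdpP[w ->] _]].
by exists (w * u), (w * v); ring.
Qed.

(** The square of a common divisor of a, b and c divides b^2 - a c = f, so such a divisor is
    constant. *)
Lemma disc_bezout a b c : b ^+ 2 - a * c = f ->
  exists u v w : {poly K}, u * a + v * (b *+ 2) + w * c = 1.
Proof.
move=> fE; have [u1 [v1 e1]] := bezout b c; have [u2 [v2 e2]] := bezout a (gcdp b c).
have ga := dvdp_gcdl a (gcdp b c).
have gbc := dvdp_gcdr a (gcdp b c).
set g := gcdp a _ in e2 ga gbc.
have gb := dvdp_trans gbc (dvdp_gcdl b c).
have gc := dvdp_trans gbc (dvdp_gcdr b c).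
have g1 : size g = 1%N.
  by apply: sqrf_free; rewrite -fE dvdp_sub ?dvdp_exp2r// expr2 dvdp_mul.
have [k k0 gk] := size_poly1P _ (introT eqP g1).
(* Division by k turns the constant gcd into 1, and 1/2 compensates the doubling of b. *)
exists (k^-1 *: u2), ((k^-1 / 2%:R) *: (v2 * u1)), (k^-1 *: (v2 * v1)).
have -> : (k^-1 / 2%:R) *: (v2 * u1) * (b *+ 2) = k^-1 *: (v2 * u1 * b).
  rewrite mulrnAr -scalerAl -scaler_nat scalerA; congr (_ *: _).
  by rewrite mulrC divfK.
rewrite -!scalerAl -!scalerDr -addrA -!mulrA -mulrDr e1 e2 gk.
by rewrite -mul_polyC -polyCM mulVf.
Qed.

(** The middle coefficient can be halved because 2 is invertible, and primitivity is
    [disc_bezout]. *)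
Lemma formsP q :
  forms f q <-> exists a b c, q = Form a (b *+ 2) c /\ b ^+ 2 - a * c = f.
Proof.
split=> [[_]|[a [b [c [-> fE]]]]].
  case: q => a b c; rewrite /disc /= => e.
  have bE : b = (2%:R^-1 *: b) *+ 2.
    by rewrite -scaler_nat scalerA divff ?scale1r.
  exists a, (2%:R^-1 *: b), c; split; first by rewrite -bE.
  apply: mulr2n_inj two_neq0 _ _ _; apply: mulr2n_inj two_neq0 _ _ _ => /=.
  have -> : f *+ 2 *+ 2 = 4%:R * f by ring.
  by rewrite -e {2}bE; ring.
split; last by rewrite /disc /= -fE; ring.
have [u [v [w e]]] := disc_bezout _ _ _ fE.
rewrite /primitive /= eqEsubset; split=> // x _.
have [_ ID IM] := ideal_gen_ideal [set a; b *+ 2; c].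
have Sa : ideal_gen [set a; b *+ 2; c] a by apply: sub_gen_smallest; left; left.
have Sb : ideal_gen [set a; b *+ 2; c] (b *+ 2) by apply: sub_gen_smallest; left; right.
have Sc : ideal_gen [set a; b *+ 2; c] c by apply: sub_gen_smallest; right.
rewrite -[x]mulr1 -e; exact: (IM x _ (ID _ _ (ID _ _ (IM u _ Sa) (IM v _ Sb)) (IM w _ Sc))).
Qed.

(** All products of generators are multiples of a, and their combinations include a^2, 2ab and ac.
    As a, 2b and c generate the unit ideal, a itself is reached. The conjugate ideal is therefore an
    inverse up to a principal factor. *)
Lemma form_ideal_conj a b c : b ^+ 2 - a * c = f ->
  ideal_mul (form_ideal f a b) (form_ideal f a (- b)) =
  ideal_gen [set qel f a 0].
Proof.
move=> fE; have fE' : (- b) ^+ 2 - a * c = f by rewrite sqrrN.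
have [u [v [w e]]] := disc_bezout _ _ _ fE.
rewrite ideal_gen1 eqEsubset; split.
  apply: ideal_mul_sub; first exact: ideal_scale_ideal.
  move=> z z' /(form_idealP _ _ _ _ fE)[s [t ->]].
  case/(form_idealP _ _ _ _ fE')=> s' [t' ->].
  exists (qel f (a * s * s' - b * s * t' + b * t * s' - c * t * t') (- (s * t' + s' * t))) => //.
  by rewrite !qelM; congr qel; rewrite -?fE; ring.
move=> _ [z _ <-]; set T := ideal_mul _ _.
have [_ TD TM] : is_ideal T by exact: ideal_mul_ideal.
rewrite mulrC; apply: (TM).
have Ia : form_ideal f a b (qel f a 0).
  by apply/(form_idealP _ _ _ _ fE); exists 1, 0; congr qel; ring.
have Ib : form_ideal f a b (qel f b (-1)).
  by apply/(form_idealP _ _ _ _ fE); exists 0, 1; congr qel; ring.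
have Ja : form_ideal f a (- b) (qel f a 0).
  by apply/(form_idealP _ _ _ _ fE'); exists 1, 0; congr qel; ring.
have Jb : form_ideal f a (- b) (qel f (- b) (-1)).
  by apply/(form_idealP _ _ _ _ fE'); exists 0, 1; congr qel; ring.
have -> : qel f a 0 = qel f u 0 * (qel f a 0 * qel f a 0)
  + (qel f v 0 * (qel f b (-1) * qel f a 0)
    + qel f (- v) 0 * (qel f a 0 * qel f (- b) (-1))
    + qel f (- w) 0 * (qel f b (-1) * qel f (- b) (-1))).
  rewrite !qelM !qelD; congr qel; last by ring.
  by rewrite -[LHS]mulr1 -[X in _ * X = _]e -fE; ring.
by do 3?[apply: (TD)]; apply: (TM); exact: mem_ideal_mul.
Qed.

Lemma lead_form_lreg a b c : b ^+ 2 - a * c = f -> GRing.lreg (qel f a 0).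
Proof.
move=> fE; have a0 := lead_form_neq0 f_aniso _ _ _ fE.
apply: (qel_lreg f_aniso); apply/eqP; rewrite -qel0 => /qel_inj[/eqP].
by rewrite (negPf a0).
Qed.

Lemma form_ideal_invertible a b c : b ^+ 2 - a * c = f ->
  invertible (form_ideal f a b).
Proof.
move=> fE; split; first exact: ideal_gen_ideal.
exists (form_ideal f a (- b)), (qel f a 0); split.
- exact: ideal_gen_ideal.
- exact: lead_form_lreg fE.
- exact: form_ideal_conj fE.
Qed.

(** The orbit belonging to the class of I. Writing elements of [Cl f] in this way turns [cl_mul]
    into [ideal_mul]. *)
Definition ideal_forms I : set (Defs.form K) :=
  [set q | exists a b c, [/\ q = Form a (b *+ 2) c, b ^+ 2 - a * c = f
                           & ideal_equiv I (form_ideal f a b)]].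

Lemma form_orbit_ideal_forms a b c : b ^+ 2 - a * c = f ->
  form_orbit (Form a (b *+ 2) c) = ideal_forms (form_ideal f a b).
Proof.
move=> fE; rewrite eqEsubset; split=> q; last first.
  by case=> a' [b' [c' [-> fE' /(form_orbit_ideal_equiv two_neq0 f_aniso _ _ _ _ _ _ fE fE')]]].
move=> oq; have [al [be [ga [de []]]]] := (form_orbitP _ _ _ _).1 oq.
set d := al * de - be * ga => du Ha Hb Hc.
(* The middle coefficient of q is twice d^-1 B, so q has the shape [a', 2b', c'] again, and its
   discriminant is still 4f. *)
set B := a * al * be + _ + _ in Hb.
have fE' : (d^-1 * B) ^+ 2 - qa q * qc q = f.
  apply: (mulrI du); apply: (mulrI du).
  have -> : d * (d * ((d^-1 * B) ^+ 2 - qa q * qc q)) =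
     (d * d^-1 * B) ^+ 2 - (d * qa q) * (d * qc q) by ring.
  by rewrite divrr // mul1r Ha Hc -fE /B /d; ring.
have qE : q = Form (qa q) ((d^-1 * B) *+ 2) (qc q).
  case: q Ha Hb Hc oq fE' => a' b' c' /= Ha Hb Hc oq _; congr Form.
  by apply: (mulrI du); rewrite Hb mulrnAr mulrA divrr // mul1r.
exists (qa q), (d^-1 * B), (qc q); split=> //.
by apply/(form_orbit_ideal_equiv two_neq0 f_aniso _ _ _ _ _ _ fE fE'); rewrite -qE.
Qed.

Lemma eq_ideal_forms I J : ideal_equiv I J -> ideal_forms I = ideal_forms J.
Proof.
move=> IJ; rewrite eqEsubset; split=> q [a [b [c [-> fE e]]]];
  exists a, b, c; split=> //.
  exact: ideal_equiv_trans (ideal_equiv_sym IJ) e.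
exact: ideal_equiv_trans IJ e.
Qed.

(** The ideal classes reached by forms. They are closed under products and inverses by
    [form_class_mul] and [form_class_inv], so the group arguments can stay among them. *)
Definition form_class I : Prop :=
  exists a b c, b ^+ 2 - a * c = f /\ ideal_equiv I (form_ideal f a b).

Lemma form_ideal_class a b c : b ^+ 2 - a * c = f -> form_class (form_ideal f a b).
Proof. by move=> fE; exists a, b, c; split=> //; exact: ideal_equiv_refl. Qed.

Lemma ClP C : Cl f C <-> exists2 I, form_class I & C = ideal_forms I.
Proof.
split=> [[q /formsP[a [b [c [-> fE]]]] <-]|[I [a [b [c [fE e]]]] ->]].
  exists (form_ideal f a b); first exact: form_ideal_class fE.
  exact: form_orbit_ideal_forms.
exists (Form a (b *+ 2) c); first by apply/formsP; exists a, b, c.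
by rewrite (form_orbit_ideal_forms _ _ _ fE) (eq_ideal_forms _ _ e).
Qed.

Lemma ideal_forms_form I a b c : ideal_forms I (Form a (b *+ 2) c) ->
  b ^+ 2 - a * c = f /\ ideal_equiv I (form_ideal f a b).
Proof. by case=> a' [b' [c' [[-> /(mulr2n_inj two_neq0)-> ->]]]]. Qed.

Lemma cl_pic_ideal_forms I : form_class I -> cl_pic f (ideal_forms I) = ideal_class I.
Proof.
case=> a [b [c [fE e]]]; rewrite eqEsubset; split=> J.
  by case=> a' [b' [c' [/ideal_forms_form[_ /ideal_class_eq->]]]].
move=> IJ; exists a, b, c; split; last by rewrite -(ideal_class_eq e).
by exists a, b, c.
Qed.

(** Form ideals are invertible, so [pic_mul] multiplies representatives, and [pic_cl] selects the
    forms whose ideal is proportional to the product. *)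
Lemma cl_mul_ideal_forms I J : form_class I -> form_class J ->
  cl_mul f (ideal_forms I) (ideal_forms J) = ideal_forms (ideal_mul I J).
Proof.
move=> cI cJ; rewrite /cl_mul !cl_pic_ideal_forms //.
case: cI => a1 [b1 [c1 [fE1 e1]]]; case: cJ => a2 [b2 [c2 [fE2 e2]]].
rewrite (ideal_class_eq e1) (ideal_class_eq e2) pic_mul_class;
  [|exact: form_ideal_invertible fE1|exact: form_ideal_invertible fE2].
rewrite -(ideal_class_eq (ideal_equiv_mul e1 e2)).
rewrite eqEsubset; split=> q.
  case=> /formsP[a [b [c [-> fE]]]].
  rewrite (form_orbit_ideal_forms _ _ _ fE) cl_pic_ideal_forms; last exact: form_ideal_class fE.
  move/esym/(ideal_class_inj (form_ideal_invertible _ _ _ fE)) => e.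
  by exists a, b, c.
case=> a [b [c [-> fE e]]]; split; first by apply/formsP; exists a, b, c.
rewrite (form_orbit_ideal_forms _ _ _ fE) cl_pic_ideal_forms; last exact: form_ideal_class fE.
by rewrite (ideal_class_eq e).
Qed.

End ClassGroup.

(** * Values coprime to a given polynomial, and composition of forms *)

(** In characteristic 0 the integers from 0 to [size s] have distinct images, one more than s has
    entries. *)
Lemma pchar0_fresh {K : fieldType} (charK0 : [pchar K] =i pred0) (s : seq K) :
  exists t : K, t \notin s.
Proof.
pose r : seq K := [seq n%:R | n <- iota 0 (size s).+1].
have ltn_neq m n : (m < n)%N -> m%:R != n%:R :> K.
  move=> mn; rewrite eq_sym -subr_eq0 -natrB; last exact: ltnW.
  by rewrite ((pcharf0P K).1 charK0) subn_eq0 -ltnNge.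
have ur : uniq r.
  rewrite map_inj_uniq ?iota_uniq // => m n e.
  by case: (ltngtP m n) => // /ltn_neq; rewrite e eqxx.
have /allPn[t _ ts] : ~~ all (mem s) r.
  apply/negP => /allP rs; have := uniq_leq_size ur rs.
  by rewrite size_map size_iota ltnn.
by exists t.
Qed.

Section Composition.
Local Open Scope classical_set_scope.
Context {K : fieldType} {f : {poly K}}.
Context (charK0 : [pchar K] =i pred0).
Context (two_neq0 : 2%:R != 0 :> K).
Context (sqrf_free : square_free f).
Context (f_aniso : forall x y : {poly K}, x ^+ 2 = f * y ^+ 2 -> x = 0 /\ y = 0).
Implicit Types (a b c u v x y h : {poly K}) (q : Defs.form K).
Implicit Types I J : set (coord_ring f).

(* A proper common divisor of h and some value lets us split h.  Otherwise
   every value is coprime to h or divisible by h, and three values divisible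
   by h would force h to divide a, 2b and c. *)
Lemma coprime_value_cofinite a b c h : b ^+ 2 - a * c = f -> h != 0 ->
  exists s : seq K, forall t : K, t \notin s ->
    coprimep (a + b * t%:P *+ 2 + c * t%:P ^+ 2) h.
Proof.
move=> fE; set P := fun t : K => a + b * t%:P *+ 2 + c * t%:P ^+ 2.
have [n] := ubnP (size h); elim: n h => // n IHn h /ltnSE hn h0.
case: (pselect (exists t, (1 < size (gcdp (P t) h) < size h)%N)).
  case=> t; set d := gcdp _ _ => /andP[d1 dh].
  have /dvdpP[e hE] : d %| h by exact: dvdp_gcdr.
  have d0 : d != 0 by rewrite -size_poly_gt0 (leq_trans _ d1).
  have e0 : e != 0 by apply: contraNneq h0; rewrite hE => ->; rewrite mul0r.
  have eh : (size e < size h)%N.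
    rewrite hE size_mul // -subn1 ltn_subRL addnC ltn_add2l.
    exact: d1.
  have [s1 Hs1] := IHn _ (leq_trans dh hn) d0.
  have [s2 Hs2] := IHn _ (leq_trans eh hn) e0.
  exists (s1 ++ s2) => t'; rewrite mem_cat negb_or => /andP[/Hs1 c1 /Hs2 c2].
  by rewrite hE coprimepMr c1 c2.
move=> nproper.
have dich t : coprimep (P t) h \/ h %| P t.
  have [|h1] := boolP (coprimep (P t) h); [by left|right].
  have gh : (size h <= size (gcdp (P t) h))%N.
    rewrite leqNgt; apply/negP => lt; apply: nproper; exists t; rewrite lt andbT.
    rewrite ltn_neqAle eq_sym [_ != _]h1 size_poly_gt0 gcdp_eq0 (negPf h0).
    by rewrite andbF.
  have := dvdp_size_eqp (dvdp_gcdr (P t) h).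
  rewrite eqn_leq gh dvdp_leq ?dvdp_gcdr //= => /esym/andP[_ hg].
  exact: dvdp_trans hg (dvdp_gcdl _ _).
have [h1|h1] := eqVneq (size h) 1%N.
  exists [::] => t _; rewrite /coprimep eqn_leq size_poly_gt0 gcdp_eq0 (negPf h0) andbF.
  by rewrite andbT -h1 dvdp_leq ?dvdp_gcdr.
have diff t t' : h %| P t -> h %| P t' -> t != t' ->
    h %| b *+ 2 + c * (t + t')%:P.
  move=> ht ht' tt'; have /(dvdp_sub ht) := ht'.
  have -> : P t - P t' = (t - t')%:P * (b *+ 2 + c * (t + t')%:P).
    by rewrite /P !rmorphD rmorphN /=; ring.
  by rewrite mul_polyC dvdpZr // subr_eq0.
have two t1 t2 t3 : h %| P t1 -> h %| P t2 -> h %| P t3 ->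
    t1 != t2 -> t1 != t3 -> t2 != t3 -> False.
  move=> p1 p2 p3 n12 n13 n23.
  have d12 := diff _ _ p1 p2 n12; have d13 := diff _ _ p1 p3 n13.
  have hc : h %| c.
    have := dvdp_sub d12 d13.
    have -> : b *+ 2 + c * (t1 + t2)%:P - (b *+ 2 + c * (t1 + t3)%:P) =
      (t2 - t3)%:P * c by rewrite !rmorphD rmorphN /=; ring.
    by rewrite mul_polyC dvdpZr // subr_eq0.
  have hb : h %| b *+ 2.
    by move: d12; rewrite dvdp_addl // dvdp_mulr.
  have ha : h %| a.
    move: p1; rewrite /P dvdp_addl ?dvdp_mulr // dvdp_addl //.
    by rewrite -mulrnAl dvdp_mulr.
  have [u [v [w e]]] := disc_bezout two_neq0 sqrf_free _ _ _ fE.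
  move: h1; rewrite -dvdp1 -e.
  by rewrite !dvdp_add // dvdp_mull.
(* At most two constants give a value divisible by h; these make up the exceptional list. *)
case: (pselect (exists t, h %| P t)) => [[t1 p1]|no]; last first.
  by exists [::] => t _; have [//|ht] := dich t; case: no; exists t.
case: (pselect (exists t, h %| P t /\ t1 != t)) => [[t2 [p2 n12]]|no].
  exists [:: t1; t2] => t; rewrite !inE negb_or => /andP[n1 n2].
  have [//|p3] := dich t; case: (two _ _ _ p1 p2 p3 n12) => //; by rewrite eq_sym.
exists [:: t1] => t; rewrite inE => n1; have [//|p2] := dich t.
by case: no; exists t; rewrite eq_sym.
Qed.

(** A unimodular substitution with first column (1, t) makes the value at (1, t) the leading
    coefficient, for a constant t outside the exceptional list. *)
Lemma coprime_form a b c h : b ^+ 2 - a * c = f -> h != 0 ->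
  exists a' b' c', [/\ b' ^+ 2 - a' * c' = f, coprimep a' h
                     & ideal_equiv (form_ideal f a b) (form_ideal f a' b')].
Proof.
move=> fE h0; have [s Hs] := coprime_value_cofinite _ _ _ _ fE h0.
have [t /Hs ct] := pchar0_fresh charK0 s.
exists (a + b * t%:P *+ 2 + c * t%:P ^+ 2), (b + c * t%:P), c.
have fE' : (b + c * t%:P) ^+ 2 - (a + b * t%:P *+ 2 + c * t%:P ^+ 2) * c = f.
  by rewrite -fE; ring.
split=> //; apply/(form_orbit_ideal_equiv two_neq0 f_aniso _ _ _ _ _ _ fE fE').
apply/form_orbitP; exists 1, 0, t%:P, 1.
by rewrite mul0r subr0 mulr1 unitr1; split=> //=; ring.
Qed.

(** Only b modulo a matters for the ideal, since a is a generator. This allows two forms to be given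
    a common b. *)
Lemma form_ideal_shift a b c k : b ^+ 2 - a * c = f ->
  (b + a * k) ^+ 2 - a * (c + b * k *+ 2 + a * k ^+ 2) = f /\
  form_ideal f a (b + a * k) = form_ideal f a b.
Proof.
move=> fE.
have fE' : (b + a * k) ^+ 2 - a * (c + b * k *+ 2 + a * k ^+ 2) = f.
  by rewrite -fE; ring.
split=> //; rewrite eqEsubset; split=> z.
  case/(form_idealP _ _ _ _ fE')=> u [v ->]; apply/(form_idealP _ _ _ _ fE).
  by exists (u + k * v), v; congr qel; ring.
case/(form_idealP _ _ _ _ fE)=> u [v ->]; apply/(form_idealP _ _ _ _ fE').
by exists (u - k * v), v; congr qel; ring.
Qed.

(** Dirichlet composition: the product contains a1 a2, a1 (b - Y), a2 (b - Y) and (b - Y)^2 = 2b (b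
    - Y) - a1 a2 c, and the Bezout relation combines these to b - Y. *)
Lemma form_ideal_mul a1 a2 b c s t w :
  b ^+ 2 - a1 * a2 * c = f -> s * a1 + t * a2 + w * (b *+ 2) = 1 ->
  ideal_mul (form_ideal f a1 b) (form_ideal f a2 b) = form_ideal f (a1 * a2) b.
Proof.
move=> fE e.
have fE1 : b ^+ 2 - a1 * (a2 * c) = f by rewrite mulrA.
have fE2 : b ^+ 2 - a2 * (a1 * c) = f by rewrite mulrCA mulrA.
rewrite eqEsubset; split.
  apply: ideal_mul_sub; first exact: ideal_gen_ideal.
  move=> z z' /(form_idealP _ _ _ _ fE1)[u [v ->]].
  case/(form_idealP _ _ _ _ fE2)=> u' [v' ->]; apply/(form_idealP _ _ _ _ fE).
  exists (u * u' - c * v * v'), (a1 * u * v' + a2 * u' * v + b * v * v' *+ 2).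
  by rewrite qelM; congr qel; rewrite -?fE; ring.
move=> z /(form_idealP _ _ _ _ fE)[u [v ->]]; set T := ideal_mul _ _.
have [_ TD TM] : is_ideal T by exact: ideal_mul_ideal.
have Ia : form_ideal f a1 b (qel f a1 0).
  by apply/(form_idealP _ _ _ _ fE1); exists 1, 0; congr qel; ring.
have Ib : form_ideal f a1 b (qel f b (-1)).
  by apply/(form_idealP _ _ _ _ fE1); exists 0, 1; congr qel; ring.
have Ja : form_ideal f a2 b (qel f a2 0).
  by apply/(form_idealP _ _ _ _ fE2); exists 1, 0; congr qel; ring.
have Jb : form_ideal f a2 b (qel f b (-1)).
  by apply/(form_idealP _ _ _ _ fE2); exists 0, 1; congr qel; ring.
have -> : qel f (a1 * a2 * u + b * v) (- v) =
  qel f (u + v * w * c) 0 * (qel f a1 0 * qel f a2 0)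
  + (qel f (v * s) 0 * (qel f a1 0 * qel f b (-1))
    + qel f (v * t) 0 * (qel f b (-1) * qel f a2 0)
    + qel f (v * w) 0 * (qel f b (-1) * qel f b (-1))).
  rewrite !qelM !qelD; congr qel.
    rewrite -[X in _ + b * X = _]mulr1 -[X in _ + b * (_ * X) = _]e -fE; ring.
  rewrite -[X in - X = _]mulr1 -[X in - (_ * X) = _]e; ring.
by do 3?[apply: (TD)]; apply: (TM); exact: mem_ideal_mul.
Qed.

(** The first leading coefficient is chosen coprime to h and the second coprime to a1 h, so that the
    forms can be composed while both coefficients stay coprime to h. *)
Lemma form_class_compose I J h : h != 0 -> form_class I -> form_class J ->
  exists a1 a2 b c, [/\ b ^+ 2 - a1 * a2 * c = f,
    ideal_equiv I (form_ideal f a1 b), ideal_equiv J (form_ideal f a2 b),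
    ideal_equiv (ideal_mul I J) (form_ideal f (a1 * a2) b)
  & coprimep a1 h && coprimep a2 h].
Proof.
move=> h0 [a [b [c [fE e]]]] [a' [b' [c' [fE' e']]]].
have [a1 [b1 [c1 [fE1 cop1 e1]]]] := coprime_form _ _ _ _ fE h0.
have a10 := lead_form_neq0 f_aniso _ _ _ fE1.
have [a2 [b2 [c2 [fE2]]]] := coprime_form _ _ _ _ fE' (mulf_neq0 a10 h0).
rewrite coprimepMr => /andP[cop12 cop2] e2.
have [u [v uv]] := bezout_coprime _ _ cop12.
(* Chinese remainders: B is b1 modulo a1 and b2 modulo a2. *)
set B := b1 + a1 * (v * (b2 - b1)).
have BE : B = b2 + a2 * (u * (b1 - b2)).
  rewrite /B -[b1 in LHS]mulr1 -[b2 in RHS]mulr1 -[X in b1 * X + _]uv.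
  by rewrite -[X in _ = b2 * X + _]uv; ring.
have [F1 I1] := form_ideal_shift _ _ _ (v * (b2 - b1)) fE1.
have [F2 I2] := form_ideal_shift _ _ _ (u * (b1 - b2)) fE2.
rewrite -/B in F1 I1; rewrite -BE in F2 I2.
set C1 := _ + _ + _ in F1; set C2 := _ + _ + _ in F2.
have CE : a1 * C1 = a2 * C2.
  by apply: oppr_inj; apply: (addrI (B ^+ 2)); rewrite F1.
(* Both a1 and a2 divide B^2 - f; being coprime, so does their product. *)
have CE1 : C1 = a2 * (v * C2 + u * C1).
  rewrite -[LHS]mul1r -uv.
  have -> : a2 * (v * C2 + u * C1) = v * (a2 * C2) + u * a2 * C1 by ring.
  by rewrite -CE; ring.
have FB : B ^+ 2 - a1 * a2 * (v * C2 + u * C1) = f by rewrite -mulrA -CE1.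
have i1 : ideal_equiv I (form_ideal f a1 B).
  by rewrite I1; exact: ideal_equiv_trans e e1.
have i2 : ideal_equiv J (form_ideal f a2 B).
  by rewrite I2; exact: ideal_equiv_trans e' e2.
exists a1, a2, B, (v * C2 + u * C1); split=> //; last by rewrite cop1 cop2.
rewrite -(form_ideal_mul _ _ _ _ v u 0 FB); first exact: ideal_equiv_mul.
by rewrite mul0r addr0 addrC.
Qed.

Lemma form_class_mul I J : form_class I -> form_class J -> form_class (ideal_mul I J).
Proof.
move=> cI cJ; have [a1 [a2 [b [c [fE _ _ e _]]]]] :=
  form_class_compose _ _ _ (oner_neq0 _) cI cJ.
by exists (a1 * a2), b, c.
Qed.

Lemma form_class_inv I : form_class I ->
  exists2 J, form_class J & ideal_equiv (ideal_mul I J) setT.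
Proof.
case=> a [b [c [fE e]]]; exists (form_ideal f a (- b)).
  by apply: (form_ideal_class _ _ c); rewrite sqrrN.
apply: ideal_equiv_trans (ideal_equiv_mul e (ideal_equiv_refl _)) _.
rewrite (form_ideal_conj two_neq0 sqrf_free _ _ _ fE) ideal_gen1.
exact/ideal_equiv_scale/lead_form_lreg/fE.
Qed.

End Composition.

(** * The genus of a class and its multiplicativity *)

Section Genus.
Local Open Scope classical_set_scope.
Context {K : fieldType} {f : {poly K}}.
Context (charK0 : [pchar K] =i pred0).
Context (two_neq0 : 2%:R != 0 :> K).
Context (sqrf_free : square_free f).
Context (f_aniso : forall x y : {poly K}, x ^+ 2 = f * y ^+ 2 -> x = 0 /\ y = 0).
Context (f_monic : f \is monic) (f_size : (1 < size f)%N).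
Implicit Types (a b c x y : {poly K}) (q : Defs.form K).
Implicit Types I J : set (coord_ring f).

Lemma in_qpoly_eq0 x : (in_qpoly f x == 0) = (f %| x).
Proof.
rewrite -val_eqE /= /mk_monic f_size f_monic /=.
by rewrite -Pdiv.IdomainMonic.modpE.
Qed.

Lemma in_qpoly_unit x : coprimep x f -> in_qpoly f x \is a GRing.unit.
Proof.
case/bezout_coprime=> u [v e]; apply/unitrPr; exists (in_qpoly f u).
apply/eqP; rewrite -rmorphM -subr_eq0 -(rmorph1 (in_qpoly f)) -rmorphB in_qpoly_eq0.
rewrite -e; have -> : x * u - (u * x + v * f) = - v * f by ring.
exact: dvdp_mull.
Qed.

Lemma eq_genus_coset (u u' : {poly %/ f}) : genus_coset u u' ->
  genus_coset u = genus_coset u'.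
Proof.
case=> k [l [k0 lu ->]]; rewrite eqEsubset; split=> v [k' [l' [k0' lu' ->]]].
  exists (k' / k), (l' / l); split.
  - by rewrite mulf_neq0 ?invr_eq0.
  - by rewrite unitrM lu' unitrV.
  rewrite -!mulrA; congr (_ * _).
  by rewrite -scalerAl -scalerAr scalerA (mulrC k) divfK // -exprMn (mulrC l) divrK.
exists (k * k'), (l * l'); split; [exact: mulf_neq0|by rewrite unitrM lu|].
by rewrite -mulrA; congr (_ * _); rewrite -scalerAl -scalerAr scalerA exprMn.
Qed.

Lemma genus_coset_refl (u : {poly %/ f}) : genus_coset u u.
Proof. by exists 1, 1; rewrite oner_neq0 unitr1 expr1n scale1r mulr1. Qed.

(* In L the values a, a' of equivalent forms satisfy k a a' = m ^ 2 with k
   constant, so a'^-1 = a^-1 k (a / m) ^ 2. *)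
Lemma genus_coset_equiv a b c a' b' c' :
  b ^+ 2 - a * c = f -> b' ^+ 2 - a' * c' = f ->
  coprimep a f -> coprimep a' f ->
  ideal_equiv (form_ideal f a b) (form_ideal f a' b') ->
  genus_coset (in_qpoly f a)^-1 = genus_coset (in_qpoly f a')^-1.
Proof.
move=> fE fE' /in_qpoly_unit ua /in_qpoly_unit ua'.
move=> /(form_orbit_ideal_equiv two_neq0 f_aniso _ _ _ _ _ _ fE fE').
case/form_orbitP=> al [be [ga [de [/= du Ha _ _]]]].
move: du; rewrite poly_unitE => /andP[/size_poly1P[k k0 dE] _].
rewrite dE in Ha.
(* Completing the square: a times the value at ([al], [ga]), which is k a', equals (a [al] + b
   [ga])^2 - f [ga]^2. *)
set m := in_qpoly f (a * al + b * ga).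
have mE : m ^+ 2 = k *: (in_qpoly f a * in_qpoly f a').
  apply/eqP; rewrite /m -rmorphXn -rmorphM -linearZ -subr_eq0 -rmorphB in_qpoly_eq0 /=.
  have -> : (a * al + b * ga) ^+ 2 - k *: (a * a') = ga ^+ 2 * f.
    rewrite -mul_polyC mulrCA Ha -fE; ring.
  exact: dvdp_mull.
have um : m \is a GRing.unit.
  have : m ^+ 2 \is a GRing.unit by rewrite mE scaler_unit ?unitfE // unitrM ua.
  by rewrite unitrX_pos.
apply: eq_genus_coset; exists k, (in_qpoly f a / m); split=> //.
  by rewrite unitrM ua unitrV.
apply: (mulrI ua'); rewrite divrr //; apply: (mulrI (unitrX 2 um)).
rewrite mulr1 -!scalerAr.
have -> : m ^+ 2 * (in_qpoly f a' * ((in_qpoly f a)^-1 * (in_qpoly f a / m) ^+ 2)) =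
  (m / m) ^+ 2 * ((in_qpoly f a)^-1 * in_qpoly f a) * (in_qpoly f a * in_qpoly f a') by ring.
by rewrite divrr // mulVr // expr1n !mul1r mE.
Qed.

(** By [genus_coset_equiv] all representatives in the union contribute the same coset, so a single
    one computes it. *)
Lemma cl_genus_ideal_forms I a b c :
  b ^+ 2 - a * c = f -> ideal_equiv I (form_ideal f a b) -> coprimep a f ->
  cl_genus f (ideal_forms I) = genus_coset (in_qpoly f a)^-1.
Proof.
move=> fE e cop; rewrite eqEsubset; split=> v.
  case=> a' [b' [c' [/(ideal_forms_form two_neq0)[fE' e'] cop']]].
  rewrite (genus_coset_equiv _ _ _ _ _ _ fE fE') //.
  exact: ideal_equiv_trans (ideal_equiv_sym e) e'.
by move=> gv; exists a, b, c; split=> //; exists a, b, c.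
Qed.

Lemma genus_coset_mul (u u' v v' : {poly %/ f}) :
  genus_coset u = genus_coset u' -> genus_coset v = genus_coset v' ->
  genus_coset (u * v) = genus_coset (u' * v').
Proof.
move=> eu ev; apply: eq_genus_coset.
have [k [l [k0 lu ->]]] : genus_coset u u' by rewrite eu; exact: genus_coset_refl.
have [k' [l' [k0' lu' ->]]] : genus_coset v v' by rewrite ev; exact: genus_coset_refl.
exists (k * k'), (l * l'); split; [exact: mulf_neq0|by rewrite unitrM lu|].
by rewrite mulrACA; congr (_ * _); rewrite -scalerAl -scalerAr scalerA exprMn.
Qed.

Lemma genus_coset_sqr (u : {poly %/ f}) : u \is a GRing.unit ->
  genus_coset (u * u) = genus_coset 1.
Proof.
move=> uu; apply: eq_genus_coset; exists 1, u^-1.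
by rewrite oner_neq0 unitrV uu scale1r -expr2 -exprMn divrr // expr1n.
Qed.

Lemma form_class_genus I : form_class I -> exists2 u : {poly %/ f},
  u \is a GRing.unit & cl_genus f (ideal_forms I) = genus_coset u.
Proof.
case=> a [b [c [fE e]]].
have [a1 [b1 [c1 [fE1 cop1 e1]]]] := coprime_form charK0 two_neq0 sqrf_free f_aniso _ _ _ _ fE (monic_neq0 f_monic).
exists (in_qpoly f a1)^-1; first by rewrite unitrV in_qpoly_unit.
exact: cl_genus_ideal_forms fE1 (ideal_equiv_trans e e1) cop1.
Qed.

(** Composition with h = f represents the product by a form with leading coefficient a1 a2, still
    coprime to f. *)
Lemma cl_genus_mul I J u v : form_class I -> form_class J ->
  cl_genus f (ideal_forms I) = genus_coset u ->
  cl_genus f (ideal_forms J) = genus_coset v ->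
  cl_genus f (ideal_forms (ideal_mul I J)) = genus_coset (u * v).
Proof.
move=> cI cJ.
have [a1 [a2 [b [c [fE e1 e2 e /andP[cop1 cop2]]]]]] :=
  form_class_compose charK0 two_neq0 sqrf_free f_aniso _ _ _ (monic_neq0 f_monic) cI cJ.
have fE1 : b ^+ 2 - a1 * (a2 * c) = f by rewrite mulrA.
have fE2 : b ^+ 2 - a2 * (a1 * c) = f by rewrite mulrCA mulrA.
rewrite (cl_genus_ideal_forms _ _ _ _ fE1 e1 cop1).
rewrite (cl_genus_ideal_forms _ _ _ _ fE2 e2 cop2) => g1 g2.
rewrite (cl_genus_ideal_forms _ _ _ _ fE e) ?coprimepMl ?cop1 //.
rewrite -(genus_coset_mul _ _ _ _ g1 g2); congr genus_coset.
by rewrite rmorphM invrM ?in_qpoly_unit // mulrC.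
Qed.

Lemma cl_genus_sqr I : form_class I ->
  cl_genus f (ideal_forms (ideal_mul I I)) = genus_coset 1.
Proof.
move=> cI; have [u uu g] := form_class_genus _ cI.
by rewrite (cl_genus_mul _ _ _ _ cI cI g g) genus_coset_sqr.
Qed.

End Genus.

(** * Small solutions of a pair of congruences *)

Lemma linear_ker_neq0 (K : fieldType) m n (phi : 'rV[K]_m -> 'rV[K]_n) :
  linear phi -> (n < m)%N -> exists2 x, x != 0 & phi x = 0.
Proof.
move=> lin nm.
pose psi : {linear 'rV[K]_m -> 'rV[K]_n} :=
  HB.pack phi (GRing.isLinear.Build K _ _ _ phi lin).
have : kermx (lin1_mx psi) != 0.
  by rewrite -mxrank_eq0 mxrank_ker -lt0n subn_gt0 (leq_ltn_trans (rank_leq_col _)).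
case/rowV0Pn=> x /sub_kermxP x0 xn0; exists x => //.
by rewrite -x0 mul_rV_lin1.
Qed.

(** The congruences impose deg f + deg a linear conditions on the p + q + r coefficients of P, v and
    w. *)
Lemma small_solution (K : fieldType) (f a l b : {poly K}) p q r :
  f != 0 -> a != 0 -> ((size f).-1 + (size a).-1 < p + q + r)%N ->
  exists P v w : {poly K}, [/\ (size P <= p)%N, (size v <= q)%N, (size w <= r)%N,
    ~~ [&& P == 0, v == 0 & w == 0] & (f %| P - l * w) && (a %| P - b * v)].
Proof.
move=> f0 a0 lt.
pose P (x : 'rV[K]_(p + q + r)) := rVpoly (lsubmx (lsubmx x)).
pose v (x : 'rV[K]_(p + q + r)) := rVpoly (rsubmx (lsubmx x)).
pose w (x : 'rV[K]_(p + q + r)) := rVpoly (rsubmx x).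
pose phi x : 'rV[K]_((size f).-1 + (size a).-1) :=
  row_mx (poly_rV ((P x - l * w x) %% f)) (poly_rV ((P x - b * v x) %% a)).
have lin : linear phi.
  move=> k x y; rewrite /phi.
  have -> : P (k *: x + y) = k *: P x + P y by rewrite /P !linearP.
  have -> : v (k *: x + y) = k *: v x + v y by rewrite /v !linearP.
  have -> : w (k *: x + y) = k *: w x + w y by rewrite /w !linearP.
  rewrite scale_row_mx add_row_mx -!(linearP (@poly_rV K _)) -!modpZl -!modpD.
  by congr (row_mx (poly_rV (_ %% _)) (poly_rV (_ %% _))); rewrite -!mul_polyC; ring.
have [x x0 phi0] := linear_ker_neq0 _ _ _ _ lin lt.
exists (P x), (v x), (w x); rewrite !size_poly; split=> //.
  apply: contra x0 => /and3P[/eqP P0 /eqP v0 /eqP w0].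
  rewrite -[x]hsubmxK -[lsubmx x]hsubmxK.
  by rewrite -(rVpolyK (lsubmx (lsubmx x))) -(rVpolyK (rsubmx (lsubmx x)))
     -(rVpolyK (rsubmx x)) -/(P x) -/(v x) -/(w x) P0 v0 w0 !linear0 !row_mx0.
(* A remainder modulo h fits into [(size h).-1] coefficients, so [poly_rV] truncates nothing. *)
have small (h z : {poly K}) : h != 0 -> poly_rV (z %% h) = 0 :> 'rV_(size h).-1 -> h %| z.
  move=> h0 /(congr1 rVpoly); rewrite poly_rV_K ?linear0 => [/eqP//|].
  by rewrite -ltnS prednK ?size_poly_gt0 ?ltn_modp.
move: phi0; rewrite -(row_mx0 _ _ _ _ ) => /eq_row_mx[e1 e2].
by apply/andP; split; apply: small.
Qed.

(** * Classes of trivial genus are squares *)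

Section PrincipalGenus.
Local Open Scope classical_set_scope.
Context {K : fieldType} {f : {poly K}} {g : nat}.
Context (charK0 : [pchar K] =i pred0).
Context (two_neq0 : 2%:R != 0 :> K).
Context (sqrf_free : square_free f).
Context (f_monic : f \is monic) (f_size : size f = (2 * g + 1).+1).
Implicit Types (a b c u v w x y : {poly K}).
Implicit Types I J : set (coord_ring f).

(** For nonzero x and y the left side has even degree and the right side odd degree. *)
Lemma odd_degree_aniso x y : x ^+ 2 = f * y ^+ 2 -> x = 0 /\ y = 0.
Proof.
have [-> /eqP|y0] := eqVneq y 0.
  by rewrite expr0n mulr0 expf_eq0 => /eqP.
have [->|x0 e] := eqVneq x 0.
  move=> /esym/eqP; rewrite expr0n mulf_eq0 expf_eq0 (negPf y0) andbF orbF.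
  by rewrite (negPf (monic_neq0 f_monic)).
have := congr1 (fun p : {poly K} => size p) e.
rewrite size_monicM ?expf_neq0 // f_size.
have := size_exp x 2; have := size_exp y 2.
have := expf_neq0 2 x0; have := expf_neq0 2 y0; rewrite -!size_poly_gt0.
move: (size (y ^+ 2)) (size (x ^+ 2)) (size x) (size y) => Y X n m; clear; lia.
Qed.

Lemma square_value a b c l (k : K) : b ^+ 2 - a * c = f -> coprimep a f ->
  k != 0 -> f %| a - k *: l ^+ 2 ->
  exists u v w, coprimep u v /\
    a * u ^+ 2 + b * u * v *+ 2 + c * v ^+ 2 = k^-1 *: w ^+ 2.
Proof.
move=> fE cop k0 fal; have a0 := lead_form_neq0 odd_degree_aniso _ _ _ fE.
have f0 := monic_neq0 f_monic.
pose m := (size a).-1.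
have sa : size a = m.+1 by rewrite prednK // size_poly_gt0.
(* With m = deg a the bounds add up to m + 2g + 2, one more than the m + 2g + 1 conditions. They
   keep P^2, f v^2 and a w^2 in degree at most m + 2g, just below deg (a f). *)
have [|P [v [w [sP sv sw nz /andP[fP aP]]]]] :=
    small_solution _ f a l b (m./2 + g.+1) (uphalf m) g.+1 f0 a0.
  by rewrite f_size -/m; clear; lia.
pose T := P ^+ 2 - f * v ^+ 2 - a * (k^-1 *: w ^+ 2).
(* Modulo f both P^2 and k^-1 a w^2 are l^2 w^2. *)
have fT : f %| T.
  have -> : T = (P - l * w) * (P + l * w) - f * v ^+ 2
     - (a - k *: l ^+ 2) * (k^-1 *: w ^+ 2).
    have kk : k%:P * (k^-1)%:P = 1 by rewrite -polyCM divff.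
    rewrite /T -!mul_polyC -[X in _ = X * _ - _ - _](addr0).
    have -> : (P - l * w + 0) * (P + l * w) - f * v ^+ 2 -
      (a - k%:P * l ^+ 2) * ((k^-1)%:P * w ^+ 2) =
      P ^+ 2 - l ^+ 2 * w ^+ 2 - f * v ^+ 2 - a * ((k^-1)%:P * w ^+ 2)
      + (k%:P * (k^-1)%:P) * (l ^+ 2 * w ^+ 2) by ring.
    by rewrite kk; ring.
  by rewrite !dvdp_sub // dvdp_mulr.
(* Modulo a both P^2 and f v^2 are b^2 v^2. *)
have aT : a %| T.
  have -> : T = (P - b * v) * (P + b * v) + a * (c * v ^+ 2 - (k^-1 *: w ^+ 2)).
    by rewrite /T -fE; ring.
  by rewrite dvdp_add // dvdp_mulr.
have T0 : T = 0.
  have afT : a * f %| T by rewrite Gauss_dvdp // aT fT.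
  apply/eqP; case: eqVneq => // Tn0; have := dvdp_leq Tn0 afT.
  rewrite leqNgt => /negP[].
  rewrite size_mul // sa f_size.
  have lt3 (p q r : {poly K}) n : (size p < n -> size q < n -> size r < n ->
      size (p - q - r)%R < n)%N.
    move=> hp hq hr; rewrite (leq_ltn_trans (size_polyD _ _)) // size_polyN gtn_max hr andbT.
    by rewrite (leq_ltn_trans (size_polyD _ _)) // size_polyN gtn_max hp.
  have sq (p : {poly K}) : (size (p ^+ 2)%R <= (size p + size p).-1)%N.
    by rewrite expr2 size_polyMleq.
  apply: lt3.
  - apply: leq_ltn_trans (sq P) _.
    move: (size P) sP; clear; move=> n; lia.
  - apply: leq_ltn_trans (size_polyMleq _ _) _; have := sq v; rewrite f_size.
    move: (size (v ^+ 2)) (size v) sv; clear; move=> n n'; lia.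
  apply: leq_ltn_trans (size_polyMleq _ _) _; rewrite size_scale ?invr_eq0 // sa.
  have := sq w; move: (size (w ^+ 2)) (size w) sw; clear; move=> n n'; lia.
have [u uE] : exists u, P = a * u + b * v.
  by have /dvdpP[u e] := aP; exists u; rewrite -[P](subrK (b * v)) e mulrC.
have val_uv : a * u ^+ 2 + b * u * v *+ 2 + c * v ^+ 2 = k^-1 *: w ^+ 2.
  apply: (mulfI a0); apply/eqP; rewrite -subr_eq0; apply/eqP; rewrite -T0 /T uE -fE.
  by ring.
(* If u and v vanished, so would w and P, against the choice of a nonzero solution. *)
have uv0 : gcdp u v != 0.
  apply/negP; rewrite gcdp_eq0 => /andP[/eqP u0 /eqP v0].
  move: val_uv; rewrite u0 v0 expr0n !mulr0 mul0rn !addr0 => /esym/eqP.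
  rewrite scaler_eq0 invr_eq0 (negPf k0) expf_eq0 /= => w0.
  by move: nz; rewrite uE u0 v0 !mulr0 addr0 w0 eqxx.
set d := gcdp u v in uv0.
have cuv : coprimep (u %/ d) (v %/ d).
  by apply: coprimep_div_gcd; rewrite -negb_and -gcdp_eq0.
have ud : u = u %/ d * d by rewrite divpK // dvdp_gcdl.
have vd : v = v %/ d * d by rewrite divpK // dvdp_gcdr.
set u' := u %/ d in ud cuv; set v' := v %/ d in vd cuv.
have e : k^-1 *: w ^+ 2 = d ^+ 2 * (a * u' ^+ 2 + b * u' * v' *+ 2 + c * v' ^+ 2).
  by rewrite -val_uv ud vd; ring.
(* Since d^2 divides w^2, d divides w, and the common factor can be removed from u, v and w. *)
have dw : d %| w.
  rewrite -(@dvdp_pexp2r _ _ _ 2) // -(@dvdpZr _ k^-1) ?invr_eq0 //.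
  by rewrite e dvdp_mulr.
exists u', v', (w %/ d); split=> //.
apply: (mulfI (expf_neq0 2 uv0)); rewrite -e -[in LHS](divpK dw) exprMn.
by rewrite -scalerAr mulrC.
Qed.

Lemma principal_genus_sqr I : form_class I ->
  cl_genus f (ideal_forms I) = genus_coset 1 ->
  exists2 J, form_class J & ideal_equiv I (ideal_mul J J).
Proof.
have aniso := odd_degree_aniso.
have f1 : (1 < size f)%N by rewrite f_size addn1.
case=> a0 [b0 [c0 [fE0 e0]]] gen1.
have [a [b [c [fE cop e]]]] :=
  coprime_form charK0 two_neq0 sqrf_free aniso _ _ _ _ fE0 (monic_neq0 f_monic).
have Ie := ideal_equiv_trans e0 e.
(* That 1 lies in the coset of a^-1 says a = k l^2 in L. *)
have [k [l [k0 lu al]]] : genus_coset (in_qpoly f a)^-1 1.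
  rewrite -(cl_genus_ideal_forms two_neq0 aniso f_monic f1 _ _ _ _ fE Ie cop) gen1.
  exact: genus_coset_refl.
have ua := in_qpoly_unit f_monic f1 _ cop.
have fal : f %| a - k *: (val l) ^+ 2.
  rewrite -(in_qpoly_eq0 f_monic f1) rmorphB /= in_qpolyZ rmorphXn /=.
  have -> : in_qpoly f (val l) = l.
    by apply: val_inj; apply: in_qpoly_small; exact: size_mk_monic.
  by rewrite -[in_qpoly f a]mulr1 al mulrA divrr // mul1r subrr.
have [u [v [w [cuv val_uv]]]] := square_value _ _ _ _ _ fE cop k0 fal.
have [x [y xy]] := bezout_coprime _ _ cuv.
(* Bezout completes (u, v) to a matrix of determinant k^-1, so the twist turns the value k^-1 w^2
   into the leading coefficient w^2. *)
set be := - (k^-1 *: y); set de := k^-1 *: x.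
pose B := a * u * be + b * (u * de + be * v) + c * v * de.
pose C := a * be ^+ 2 + b * be * de *+ 2 + c * de ^+ 2.
have dE : u * de - be * v = (k^-1)%:P.
  rewrite /be /de mulNr opprK -scalerAl -scalerAr -scalerDr (mulrC u) xy.
  by rewrite -mul_polyC mulr1.
have kk : (k^-1)%:P * k%:P = 1 by rewrite -polyCM mulVf.
have : form_orbit (Form a (b *+ 2) c) (Form (w ^+ 2) ((k *: B) *+ 2) (k *: C)).
  apply/form_orbitP; exists u, be, v, de; rewrite dE; split=> /=.
  - by rewrite poly_unitE size_polyC invr_eq0 k0 coefC /= unitfE invr_eq0.
  - by rewrite val_uv mul_polyC.
  - by rewrite mulrnAr -mul_polyC mulrA kk mul1r.
  - by rewrite -mul_polyC mulrA kk mul1r.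
rewrite (form_orbit_ideal_forms two_neq0 aniso _ _ _ fE).
case/(ideal_forms_form two_neq0) => fE' e'.
move: fE' e'; set b' := k *: B; set c' := k *: C => fE' e'.
have fEw : b' ^+ 2 - w * (w * c') = f by rewrite mulrA.
(* The last coefficient of [w, 2b', w c'] is a multiple of w, so w and 2b' alone generate the unit
   ideal and this form can be composed with itself. *)
have [s [t [r str]]] := disc_bezout two_neq0 sqrf_free _ _ _ fEw.
exists (form_ideal f w b'); first exact: form_ideal_class fEw.
rewrite (form_ideal_mul w w b' c' (s + r * c') 0 t).
- by rewrite -expr2; exact: ideal_equiv_trans Ie e'.
- by rewrite -expr2.
- by rewrite -[RHS]str; ring.
Qed.

End PrincipalGenus.

(** * The principal genus and injectivity of the genus map *)

Section GenusMap.
Local Open Scope classical_set_scope.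
Context {K : fieldType} {f : {poly K}} {g : nat}.
Context (charK0 : [pchar K] =i pred0).
Context (two_neq0 : 2%:R != 0 :> K).
Context (sqrf_free : square_free f).
Context (f_monic : f \is monic) (f_size : size f = (2 * g + 1).+1).
Implicit Types I J : set (coord_ring f).

Let f_aniso := odd_degree_aniso f_monic f_size.

Let size_gt1 : (1 < size f)%N.
Proof. by rewrite f_size addn1. Qed.

Let ClP := ClP two_neq0 sqrf_free f_aniso.
Let mulE := cl_mul_ideal_forms two_neq0 sqrf_free f_aniso.
Let class_mul := form_class_mul charK0 two_neq0 sqrf_free f_aniso.
Let genus_mul :=
  cl_genus_mul charK0 two_neq0 sqrf_free f_aniso f_monic size_gt1.
Let genus_sqr :=
  cl_genus_sqr charK0 two_neq0 sqrf_free f_aniso f_monic size_gt1.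
Let class_genus :=
  form_class_genus charK0 two_neq0 sqrf_free f_aniso f_monic size_gt1.

Lemma cl_squaresP S : cl_squares f S <->
  exists2 J : set (coord_ring f), form_class J & S = ideal_forms (ideal_mul J J).
Proof.
split=> [[C /ClP[J cJ ->] <-]|[J cJ ->]]; first by exists J; rewrite ?mulE.
by exists (ideal_forms J); [apply/ClP; exists J|rewrite mulE].
Qed.

Lemma principal_genus_squares : principal_genus f = cl_squares f.
Proof.
rewrite eqEsubset; split=> C; last first.
  case/cl_squaresP=> J cJ ->; split; last exact: genus_sqr.
  by apply/ClP; exists (ideal_mul J J) => //; exact: class_mul.
case=> /ClP[I cI ->] gen; apply/cl_squaresP.
have [J cJ e] := principal_genus_sqr charK0 two_neq0 sqrf_free f_monic f_size _ cI gen.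
by exists J => //; exact: eq_ideal_forms.
Qed.

Lemma cl_cosetP I C : form_class I -> cl_coset f (ideal_forms I) C <->
  exists2 J, form_class J & C = ideal_forms (ideal_mul I (ideal_mul J J)).
Proof.
move=> cI; split=> [[S /cl_squaresP[J cJ ->] <-]|[J cJ ->]].
  by exists J; rewrite ?mulE //; exact: class_mul.
exists (ideal_forms (ideal_mul J J)); first by apply/cl_squaresP; exists J.
by rewrite mulE //; exact: class_mul.
Qed.

(** Squares have trivial genus, so all members of the coset contribute the same set to the union. *)
Lemma genus_map_coset I : form_class I ->
  genus_map f (cl_coset f (ideal_forms I)) = cl_genus f (ideal_forms I).
Proof.
move=> cI; have [u _ gI] := class_genus _ cI.
have gS J : form_class J ->
    cl_genus f (ideal_forms (ideal_mul I (ideal_mul J J))) = genus_coset u.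
  by move=> cJ; rewrite (genus_mul _ _ _ _ cI (class_mul _ _ cJ cJ) gI (genus_sqr _ cJ)) mulr1.
rewrite eqEsubset; split=> v.
  by case=> C /(cl_cosetP _ _ cI)[J cJ ->]; rewrite gS // gI.
(* Some member of the coset has to be named; I times its own square serves. *)
move=> Iv; exists (ideal_forms (ideal_mul I (ideal_mul I I))).
  by apply/cl_cosetP => //; exists I.
by rewrite gS // -gI.
Qed.

(** Equal genera make the genus of I1 I2 a square, hence trivial, so I1 I2 is proportional to some
    T^2, and I1 to I2 times the square of T / I2. *)
Lemma cl_coset_sub I1 I2 : form_class I1 -> form_class I2 ->
  cl_genus f (ideal_forms I1) = cl_genus f (ideal_forms I2) ->
  cl_coset f (ideal_forms I1) `<=` cl_coset f (ideal_forms I2).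
Proof.
move=> c1 c2 e12 C /(cl_cosetP _ _ c1)[J cJ ->]; apply/(cl_cosetP _ _ c2).
have [u uu g1] := class_genus _ c1.
have [T cT eT] : exists2 T, form_class T &
    ideal_equiv (ideal_mul I1 I2) (ideal_mul T T).
  apply: (principal_genus_sqr charK0 two_neq0 sqrf_free f_monic f_size).
    exact: class_mul.
  by rewrite (genus_mul _ _ _ _ c1 c2 g1 (etrans (esym e12) g1)) genus_coset_sqr.
have [I2' c2' e2] := form_class_inv two_neq0 sqrf_free f_aniso _ c2.
(* With [I2'] inverse to I2, the square of T I2' J times I2 is proportional to I1 J^2. *)
exists (ideal_mul T (ideal_mul I2' J)); first by do 2 apply: class_mul => //.
apply: eq_ideal_forms; apply: ideal_equiv_sym.
rewrite ideal_mulACA (ideal_mulACA I2' J).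
apply: ideal_equiv_trans
  (ideal_equiv_mul (ideal_equiv_refl _)
     (ideal_equiv_mul (ideal_equiv_sym eT) (ideal_equiv_refl _))) _.
(* Regrouping collects two factors I2 I2', each proportional to the unit ideal. *)
rewrite ideal_mulA (ideal_mulC I1) (ideal_mulA I2) (ideal_mulC _ I1).
rewrite (ideal_mulC _ (ideal_mul J J)) ideal_mulACA (ideal_mulACA I2).
apply: ideal_equiv_trans
  (ideal_equiv_mul (ideal_equiv_refl _) (ideal_equiv_mul e2 e2)) _.
rewrite ideal_mulC !ideal_mul_unit //; first exact: ideal_equiv_refl.
exact: ideal_mul_ideal.
Qed.

Lemma genus_map_inj : set_inj (Cl_mod_squares f) (genus_map f).
Proof.
move=> _ _ /set_mem[_ /ClP[I1 c1 ->] <-] /set_mem[_ /ClP[I2 c2 ->] <-].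
rewrite !genus_map_coset // => e12.
by rewrite eqEsubset; split; exact: cl_coset_sub.
Qed.

End GenusMap.

Theorem theorem3p17 (K : fieldType) (charK0 : [pchar K] =i pred0)
    (g : nat) (g_ge1 : (1 <= g)%N)
    (f : {poly K}) (f_sqfree : square_free f) (f_monic : f \is monic)
    (f_deg : size f = (2 * g + 1).+1) :
  set_inj (Cl_mod_squares f) (genus_map f) /\
  principal_genus f = cl_squares f.
Proof.
have two_neq0 : 2%:R != 0 :> K by rewrite ((pcharf0P K).1 charK0).
split; first exact: genus_map_inj charK0 two_neq0 f_sqfree f_monic f_deg.
exact: principal_genus_squares charK0 two_neq0 f_sqfree f_monic f_deg.
Qed.
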